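(* Let $m\ge 2$ and let $F$ be an $m\times m$ matrix function of the form $$F(z)=\begin{pmatrix}1&0&\cdots&0&0\\0&1&\cdots&0&0\\ \vdots&\vdots&\ddots&\vdots&\vdots\\0&0&\cdots&1&0\\ \phi_1(z)&\phi_2(z)&\cdots&\phi_{m-1}(z)&1\end{pmatrix},$$ where $\phi_j\in\mathcal{R}_-$ for $j=1,2,\ldots,m-1$. Assume also that the poles of the functions $\phi_j$ are known exactly. Then there is a unique paraunitary matrix function $U\in\mathcal{R}^{m\times m}$ of the form $$U(z)=\begin{pmatrix}u_{11}(z)&u_{12}(z)&\cdots&u_{1m}(z)\\ u_{21}(z)&u_{22}(z)&\cdots&u_{2m}(z)\\ \vdots&\vdots&&\vdots\\ u_{m-1,1}(z)&u_{m-1,2}(z)&\cdots&u_{m-1,m}(z)\\ \widetilde{u_{m1}}(z)&\widetilde{u_{m2}}(z)&\cdots&\widetilde{u_{mm}}(z)\end{pmatrix},\qquad u_{ij}\in\mathcal{R}_+\ \text{ for } 1\le i,j\le m,$$ satisfying $\det U(z)=1$ for all $z$ at which $U(z)$ is defined and $U(1)=I_m$, and such that $$FU\in(\mathcal{R}_+)^{m\times m};$$ moreover, this $U$ can be constructed explicitly.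
   Context: $\mathbb{T}=\{z\in\mathbb{C}:|z|=1\}$ and $\mathbb{D}=\{z\in\mathbb{C}:|z|<1\}$. $\mathcal{R}$ is the set of rational functions (of one complex variable, with complex coefficients). $\mathcal{R}_+\subset\mathcal{R}$ is the set of rational functions all of whose poles lie outside the open disk $\mathbb{D}$ (poles on $\mathbb{T}$ and at $\infty$ are allowed; constants belong to $\mathcal{R}_+$). $\mathcal{R}_-\subset\mathcal{R}$ is the set of rational functions all of whose poles lie in $\mathbb{D}$ and which vanish at $\infty$; thus $\mathcal{R}=\mathcal{R}_+\oplus\mathcal{R}_-$. $\mathcal{S}^{m\times n}$ denotes the $m\times n$ matrices with entries in $\mathcal{S}$. For $f\in\mathcal{R}$, $\widetilde{f}(z)=\overline{f(1/\overline{z})}$, and for a matrix $G=[G_{ij}]$ with entries in $\mathcal{R}$, $\widetilde{G}=[\widetilde{G_{ji}}]$ (transpose with tilde applied to entries). A matrix $U\in\mathcal{R}^{m\times m}$ is paraunitary if $U(z)\widetilde{U}(z)=I_m$ (equivalently, $U(z)$ is unitary for each $z\in\mathbb{T}$); identities between rational functions are understood to hold wherever both sides are defined. ''Construct'' means to find the object exactly; constructing a rational function $f$ means determining coprime polynomials $p,q$ with $f=p/q$. Determining coefficients of Laurent expansions and solving systems of linear equations with known coefficients count as exact operations. *)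

(* Defs.v *)
From mathcomp Require Import all_boot all_order all_algebra.
From mathcomp Require Import complex reals.

Set Implicit Arguments.
Unset Strict Implicit.
Unset Printing Implicit Defensive.

Import Order.TTheory GRing.Theory Num.Theory.
Local Open Scope ring_scope.

Notation ratfun C := {fraction {poly C}}.
Notation "p %:F" := (@FracField.tofrac _ p) : ring_scope.

Section RationalFunctions.
Variable C : fieldType.
Implicit Types (f : ratfun C) (p q : {poly C}).

Definition reduced f p q : Prop :=
  [/\ q != 0, coprimep p q & f = p%:F / q%:F].

(* A canonical reduced form p / q; unique up to a common scalar factor. *)
Definition rnum f : {poly C} :=
  \n_(repr f) %/ gcdp \n_(repr f) \d_(repr f).
Definition rden f : {poly C} :=
  \d_(repr f) %/ gcdp \n_(repr f) \d_(repr f).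

Definition pole f (a : C) : bool := root (rden f) a.

(* Meaningful only when a is not a pole of f. *)
Definition reval f (a : C) : C := (rnum f).[a] / (rden f).[a].

Definition vanishes_at_infinity f : bool := (size (rnum f) < size (rden f))%N.

Lemma rnum_rdenP f : reduced f (rnum f) (rden f).
Proof.
rewrite /rnum /rden; set n := \n_(repr f); set d := \d_(repr f).
have d0 : d != 0 by exact: denom_ratioP.
have g0 : gcdp n d != 0 by rewrite gcdp_eq0 negb_and d0 orbT.
have En : n %/ gcdp n d * gcdp n d = n by rewrite divpK // dvdp_gcdl.
have Ed : d %/ gcdp n d * gcdp n d = d by rewrite divpK // dvdp_gcdr.
split.
- by apply: contraNneq d0 => E; rewrite -Ed E mul0r.
- by rewrite coprimep_div_gcd // d0 orbT.
have -> : f = n%:F / d%:F.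
  have n_d : Ratio n d = repr f by rewrite /n /d Ratio_numden.
  rewrite -[LHS]reprK -n_d.
  suff -> : n%:F / d%:F = (\pi_(ratfun C) (Ratio n d))%qT by [].
  have nF x : x%:F = (\pi_(ratfun C) (Ratio x 1))%qT.
    by rewrite /FracField.tofrac; unlock.
  rewrite !nF -[_^-1]/(FracField.inv _) -[_ * _]/(FracField.mul _ _).
  rewrite -FracField.pi_inv -FracField.pi_mul /FracField.invf /FracField.mulf.
  by rewrite !numden_Ratio ?oner_neq0 // mulr1 mul1r.
have dg0 : d %/ gcdp n d != 0.
  by apply: contraNneq d0 => E; rewrite -Ed E mul0r.
apply/eqP; rewrite eqr_div ?tofrac_eq0 // -!rmorphM /= tofrac_eq.
by rewrite -[X in X * (d %/ _)]En -mulrA [_ * (d %/ _)]mulrC Ed.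
Qed.

Lemma pole_reduced f p q a : reduced f p q -> pole f a = root q a.
Proof.
move=> [q0 cpq fE]; have [d0 cnd fE'] := rnum_rdenP f.
have E : p * rden f = rnum f * q.
  apply/eqP; rewrite -tofrac_eq !rmorphM /=.
  by rewrite -eqr_div ?tofrac_eq0 // -fE -fE'.
have dq : rden f %| q.
  by rewrite -(@Gauss_dvdpr _ _ (rnum f)) 1?coprimep_sym // -E dvdp_mulIr.
have qd : q %| rden f.
  by rewrite -(@Gauss_dvdpr _ _ p) 1?coprimep_sym // E dvdp_mulIr.
rewrite /pole; apply/idP/idP => r; first exact: (root_dvdp dq).
exact: (root_dvdp qd).
Qed.

Lemma reval_frac p q (a : C) : q.[a] != 0 ->
  ~~ pole (p%:F / q%:F) a /\ reval (p%:F / q%:F) a = p.[a] / q.[a].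
Proof.
move=> qa; have q0 : q != 0 by apply: contraNneq qa => ->; rewrite horner0.
set f := p%:F / q%:F; have [d0 cnd fE] := rnum_rdenP f.
have E : p * rden f = rnum f * q.
  apply/eqP; rewrite -tofrac_eq !rmorphM /=.
  by rewrite -eqr_div ?tofrac_eq0 // -fE.
have dq : rden f %| q.
  by rewrite -(@Gauss_dvdpr _ _ (rnum f)) 1?coprimep_sym // -E dvdp_mulIr.
have da : ~~ root (rden f) a.
  by apply: contra qa => r; apply: (root_dvdp dq).
split=> //; rewrite /reval; apply/eqP.
by rewrite eqr_div // -!hornerM E.
Qed.

End RationalFunctions.

Section Circle.
Variable C : numClosedFieldType.
Implicit Types (f : ratfun C) (p : {poly C}) (a : C).

Definition Rplus f : Prop := forall a, `|a| < 1 -> ~~ pole f a.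

Definition Rminus f : Prop :=
  (forall a, pole f a -> `|a| < 1) /\ vanishes_at_infinity f.

(* The rational function conj (p (1 / conj z)) = \sum_i conj p_i z^-i. *)
Definition tilde_poly p : ratfun C :=
  \sum_(i < size p) ((p`_i)^*)%:P%:F * ('X%:F)^-1 ^+ i.

Definition tilde f : ratfun C := tilde_poly (rnum f) / tilde_poly (rden f).

Lemma tilde_polyE p N : (size p <= N.+1)%N ->
  tilde_poly p = (\sum_(i < N.+1) (p`_i)^* *: 'X^(N - i))%:F / ('X^N)%:F.
Proof.
move=> sp; rewrite /tilde_poly (big_ord_widen N.+1 (fun i =>
  ((p`_i)^*)%:P%:F * ('X%:F)^-1 ^+ i) sp) big_mkcond /=.
rewrite rmorph_sum /= mulr_suml; apply: eq_bigr => i _.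
have -> : ('X^N : {poly C})%:F = ('X^(N - i))%:F * ('X%:F) ^+ i.
  by rewrite -rmorphXn -rmorphM -exprD subnK // -ltnS.
case: ltnP => [_|si]; last first.
  by rewrite nth_default // conjC0 scale0r rmorph0 mul0r.
rewrite -mul_polyC rmorphM /= invfM exprVn -mulrA.
congr (_ * _).
by rewrite mulVKf // tofrac_eq0 expf_neq0 // polyX_eq0.
Qed.

Lemma horner_conj_rev p N a : a != 0 -> (size p <= N.+1)%N ->
  (\sum_(i < N.+1) (p`_i)^* *: 'X^(N - i)).[a] = a ^+ N * (p.[(a^*)^-1])^*.
Proof.
move=> a0 sp; rewrite (horner_coef_wide _ sp) rmorph_sum /= horner_sum.
rewrite mulr_sumr; apply: eq_bigr => i _.
rewrite hornerZ hornerXn rmorphM rmorphXn /= fmorphV /= conjCK mulrCA.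
by rewrite exprVn expfB_cond // (negPf a0) add0n -ltnS.
Qed.

Lemma reval_tilde f a : a != 0 -> ~~ pole f (a^*)^-1 ->
  ~~ pole (tilde f) a /\ reval (tilde f) a = (reval f (a^*)^-1)^*.
Proof.
move=> a0 npole; pose N := maxn (size (rnum f)) (size (rden f)).
have sn : (size (rnum f) <= N.+1)%N by rewrite leqW // leq_maxl.
have sd : (size (rden f) <= N.+1)%N by rewrite leqW // leq_maxr.
rewrite /tilde (tilde_polyE sn) (tilde_polyE sd).
have XN0 : ('X^N : {poly C})%:F != 0.
  by rewrite tofrac_eq0 expf_neq0 // polyX_eq0.
rewrite invf_div mulrA divfK //.
have aN0 : a ^+ N != 0 by rewrite expf_neq0.
set P := \sum_(i < _) _; set Q := \sum_(i < _) _.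
have Qa : Q.[a] = a ^+ N * ((rden f).[(a^*)^-1])^*.
  exact: horner_conj_rev.
have Qa0 : Q.[a] != 0 by rewrite Qa mulf_neq0 // conjC_eq0.
have [-> ->] := reval_frac P Qa0; split=> //.
rewrite Qa /reval (horner_conj_rev a0 sn) invfM mulrACA divff // mul1r.
by rewrite rmorphM /= fmorphV.
Qed.

Definition tilde_mx m n (G : 'M[ratfun C]_(m, n)) : 'M[ratfun C]_(n, m) :=
  \matrix_(i, j) tilde (G j i).

Definition paraunitary m (U : 'M[ratfun C]_m) : Prop :=
  U *m tilde_mx U = 1%:M.

Definition mx_value_at m n (G : 'M[ratfun C]_(m, n)) a (A : 'M[C]_(m, n)) :=
  forall i j, ~~ pole (G i j) a /\ reval (G i j) a = A i j.

Definition Fmx k (phi : 'rV[ratfun C]_k) : 'M[ratfun C]_(k + 1) :=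
  block_mx 1%:M 0 phi 1%:M.

(* The size m >= 2 of the matrices is written k + 1, with k >= 1. *)
Record unitary_factor k (phi : 'rV[ratfun C]_k) (U : 'M[ratfun C]_(k + 1)) :
    Prop := UnitaryFactor {
  uf_paraunitary : paraunitary U;
  uf_form : exists2 u : 'M[ratfun C]_(k + 1), (forall i j, Rplus (u i j))
            & U = col_mx (usubmx u) (map_mx tilde (dsubmx u));
  uf_det : \det U = 1;
  uf_at1 : mx_value_at U 1 1%:M;
  uf_Rplus : forall i j, Rplus ((Fmx phi *m U) i j)
}.

End Circle.

(* Explicit construction is modelled by algebraic computation trees: finitely
   many exact operations on the data (the field operations, which subsume
   Laurent coefficients of rational functions at known poles and the solution
   of linear systems, and complex conjugation), with branching on whether a
   computed number is zero. No constant other than 1 is available. *)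
Inductive expr (V : Type) : Type :=
| Var of V
| One
| Opp of expr V
| Add of expr V & expr V
| Mul of expr V & expr V
| Inv of expr V
| Conj of expr V.
Arguments One {V}.

Inductive tree (V O : Type) : Type :=
| Output of O
| IfZero of expr V & tree V O & tree V O.

Section Execution.
Variables (C : numClosedFieldType) (V : Type) (env : V -> C).

Fixpoint eval (e : expr V) : C :=
  match e with
  | Var v => env v
  | One => 1
  | Opp a => - eval a
  | Add a b => eval a + eval b
  | Mul a b => eval a * eval b
  | Inv a => (eval a)^-1
  | Conj a => (eval a)^*
  end.

Fixpoint run O (t : tree V O) : O :=
  match t with
  | Output o => o
  | IfZero e t0 t1 => if eval e == 0 then run t0 else run t1
  end.

Definition eval_poly (s : seq (expr V)) : {poly C} := Poly (map eval s).

End Execution.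

(* The data: the coefficients of p_j and q_j, where phi_j = p_j / q_j in lowest
   terms, and a list of the poles of phi_j. *)
Inductive datum (k : nat) : Type :=
| NumCoef of 'I_k & nat
| DenCoef of 'I_k & nat
| Pole of 'I_k & nat.

Record rowdata (C : fieldType) (k : nat) := RowData {
  rd_num : 'I_k -> {poly C};
  rd_den : 'I_k -> {poly C};
  rd_poles : 'I_k -> seq C
}.

Definition describes (C : fieldType) k (D : rowdata C k)
    (phi : 'rV[ratfun C]_k) : Prop :=
  forall j, reduced (phi 0 j) (rd_num D j) (rd_den D j)
         /\ forall a, (a \in rd_poles D j) = pole (phi 0 j) a.

Definition data_env (C : fieldType) k (D : rowdata C k) (v : datum k) : C :=
  match v with
  | NumCoef j l => (rd_num D j)`_l
  | DenCoef j l => (rd_den D j)`_l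
  | Pole j l => (rd_poles D j)`_l
  end.

Definition data_format (C : fieldType) k (D : rowdata C k) :
    'I_k -> nat * nat * nat :=
  fun j => (size (rd_num D j), size (rd_den D j), size (rd_poles D j)).

(* A computation tree for each format of the data; it outputs, for every entry
   of U, the coefficients of a numerator and of a denominator. *)
Definition algorithm k : Type :=
  ('I_k -> nat * nat * nat) ->
  tree (datum k)
       ('I_(k + 1) -> 'I_(k + 1) -> seq (expr (datum k)) * seq (expr (datum k))).

Definition constructs (C : numClosedFieldType) k (A : algorithm k)
    (D : rowdata C k) (U : 'M[ratfun C]_(k + 1)) : Prop :=
  let out := run (data_env D) (A (data_format D)) in
  forall i j, reduced (U i j) (eval_poly (data_env D) (out i j).1)
                              (eval_poly (data_env D) (out i j).2).

(* Main.v *)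
Require Import Defs.
From HB Require Import structures.
From mathcomp Require Import all_boot all_order all_algebra.
From mathcomp Require Import complex reals boolp ring.

(** Write [star N p] for the polynomial z^N conj (p (1 / conj z)) and
phi_i = p_i / q with q of degree N, all of whose roots lie in the open disk.
Call a matrix U good if F U and U~ F^-1 lie in R_+ and U has no pole on the
circle.  If U and V are good then U~ V = (U~ F^-1) (F V) and its tilde V~ U
both lie in R_+, so U~ V has no poles on the sphere: it is constant, hence
determined by the values at 1.  Every U of the theorem is good, which gives
uniqueness; conversely a good U with U(1) = I is paraunitary.

Looking for good columns with entries a_i / star N q (i < m) and a_m / q turns
goodness into polynomial congruences for the a_i.  Together with the value at 1
they form a square linear system in the coefficients.  A solution of the
homogeneous system is a good column X vanishing at 1, so X~ X = 0 and X = 0: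
the system is invertible.  Cramer's rule then gives the entries of U by a fixed
expression in the data, and Euclid's algorithm puts them in lowest terms. *)

Set Implicit Arguments.
Unset Strict Implicit.
Unset Printing Implicit Defensive.

Import Order.TTheory GRing.Theory Num.Theory.
Local Open Scope ring_scope.

(** * Poles and values *)

Section Values.
Variable C : fieldType.
Implicit Types (f g : ratfun C) (p q : {poly C}) (a c : C).

Lemma ratfunP f : exists p q, q != 0 /\ f = p%:F / q%:F.
Proof. by exists (rnum f), (rden f); case: (rnum_rdenP f). Qed.

Lemma eqr_frac p q p' q' : q != 0 -> q' != 0 ->
  (p%:F / q%:F == p'%:F / q'%:F) = (p * q' == p' * q).
Proof. by move=> q0 q'0; rewrite eqr_div ?tofrac_eq0 // -!rmorphM /= tofrac_eq. Qed.

(** [reval] is meaningful only away from poles, so regularity and value are carried together;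
    regularity is then the first projection. *)
Definition takes f a c : Prop := ~~ pole f a /\ reval f a = c.

Lemma takesP f a c : takes f a c <->
  exists p q, [/\ q.[a] != 0, f = p%:F / q%:F & c = p.[a] / q.[a]].
Proof.
split=> [[npole <-]|[p [q [qa -> ->]]]]; last exact: reval_frac.
by exists (rnum f), (rden f); case: (rnum_rdenP f).
Qed.

Lemma takes_inj f a c c' : takes f a c -> takes f a c' -> c = c'.
Proof. by case=> _ <- [_ <-]. Qed.

Lemma nopole_takes f a : ~~ pole f a -> takes f a (reval f a).
Proof. by []. Qed.

Lemma takesC c a : takes c%:P%:F a c.
Proof.
apply/takesP; exists c%:P, 1.
by rewrite hornerC hornerE oner_neq0 rmorph1 !divr1.
Qed.

Lemma takesD f g a c d : takes f a c -> takes g a d -> takes (f + g) a (c + d).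
Proof.
move=> /takesP[p [q [qa -> ->]]] /takesP[p' [q' [q'a -> ->]]].
have q0 : q != 0 by apply: contraNneq qa => ->; rewrite horner0.
have q'0 : q' != 0 by apply: contraNneq q'a => ->; rewrite horner0.
apply/takesP; exists (p * q' + p' * q), (q * q'); split.
- by rewrite hornerM mulf_neq0.
- by rewrite addf_div ?tofrac_eq0 // !(rmorphM, rmorphD).
- by rewrite addf_div // !hornerE.
Qed.

Lemma takesM f g a c d : takes f a c -> takes g a d -> takes (f * g) a (c * d).
Proof.
move=> /takesP[p [q [qa -> ->]]] /takesP[p' [q' [q'a -> ->]]].
apply/takesP; exists (p * p'), (q * q'); split.
- by rewrite hornerM mulf_neq0.
- by rewrite mulf_div !rmorphM.
- by rewrite mulf_div !hornerE.
Qed.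

Lemma takes_sum n (f : 'I_n -> ratfun C) a (c : 'I_n -> C) :
  (forall i, takes (f i) a (c i)) -> takes (\sum_i f i) a (\sum_i c i).
Proof.
move=> fc; elim/big_ind2: _ => // [|f1 c1 f2 c2]; last exact: takesD.
by rewrite -(rmorph0 (@FracField.tofrac {poly C})) -polyC0; apply: takesC.
Qed.

Lemma common_denominator n (f : 'I_n -> ratfun C) :
  exists d (g : 'I_n -> {poly C}), d != 0 /\ forall i, f i = (g i)%:F / d%:F.
Proof.
pose d := \prod_i rden (f i).
have dn0 i : rden (f i) != 0 by case: (rnum_rdenP (f i)).
exists d, (fun i => rnum (f i) * \prod_(j | j != i) rden (f j)).
split=> [|i]; first by apply/prodf_neq0 => i _.
have [_ _ {1}->] := rnum_rdenP (f i).
apply/eqP; rewrite eqr_frac //; last by apply/prodf_neq0 => j _.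
by rewrite /d (bigD1 i) //= -mulrA [X in _ == _ * X]mulrC.
Qed.

End Values.

(** * Reversal of polynomials and the tilde operation *)

Section Reversal.
Variable C : numClosedFieldType.
Implicit Types (f g : ratfun C) (p q : {poly C}) (a : C) (N : nat).

(* For [size p <= N.+1], the polynomial z^N conj (p (1 / conj z)). *)
Definition star N p : {poly C} := \sum_(i < N.+1) (p`_i)^* *: 'X^(N - i).

Lemma coef_star N p i : (star N p)`_i = if (i <= N)%N then (p`_(N - i))^* else 0.
Proof.
rewrite /star coef_sum; case: leqP => iN.
  have Ni : (N - i < N.+1)%N by rewrite ltnS leq_subr.
  rewrite (bigD1 (Ordinal Ni)) //= coefZ coefXn subKn // eqxx mulr1 big1 ?addr0 //.
  move=> j jn; rewrite coefZ coefXn; case: eqP => [E|]; last by rewrite mulr0.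
  by case/eqP: jn; apply: val_inj; rewrite /= E subKn // -ltnS.
rewrite big1 // => j _; rewrite coefZ coefXn; case: eqP => [E|]; last by rewrite mulr0.
by move: iN; rewrite E ltnNge leq_subr.
Qed.

Lemma size_star N p : (size (star N p) <= N.+1)%N.
Proof. by apply/leq_sizeP => j jN; rewrite coef_star leqNgt jN. Qed.

Lemma starK N p : (size p <= N.+1)%N -> star N (star N p) = p.
Proof.
move=> sp; apply/polyP => i; rewrite coef_star; case: leqP => iN.
  by rewrite coef_star leq_subr subKn // conjCK.
by rewrite nth_default // (leq_trans sp).
Qed.

Lemma star_eq0 N p : (size p <= N.+1)%N -> (star N p == 0) = (p == 0).
Proof.
move=> sp; have star0 : star N 0 = 0.
  by apply/polyP => i; rewrite coef_star !coef0 conjC0 if_same.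
apply/eqP/eqP => [E|->] //; by rewrite -(starK sp) E.
Qed.

Lemma root_star N p a : a != 0 -> (size p <= N.+1)%N ->
  root (star N p) a = root p (a^*)^-1.
Proof.
move=> a0 sp; rewrite /root /star horner_conj_rev //.
by rewrite mulf_eq0 expf_eq0 (negPf a0) andbF conjC_eq0.
Qed.

(** The constant term of [star N p] is the conjugate of the coefficient of index N, which is the
    leading one because the size is exactly [N.+1]. *)
Lemma root_star0 N p : size p = N.+1 -> ~~ root (star N p) 0.
Proof.
move=> sp; rewrite /root horner_coef0 coef_star subn0 conjC_eq0.
have -> : N = (size p).-1 by rewrite sp.
by rewrite -/(lead_coef p) lead_coef_eq0 -size_poly_eq0 sp.
Qed.

(** Presents [tilde_poly] as evaluation at 1/z of a polynomial with conjugated coefficients, so that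
    its algebraic rules are those of evaluation. *)
Let conjF : {rmorphism C -> ratfun C} := (@FracField.tofrac _) \o polyC \o Num.conj.

Lemma tilde_poly_horner p : tilde_poly p = (map_poly conjF p).['X%:F^-1].
Proof.
rewrite horner_coef size_map_poly; apply: eq_bigr => i _.
by rewrite coef_map.
Qed.

Lemma tilde_polyM p q : tilde_poly (p * q) = tilde_poly p * tilde_poly q.
Proof. by rewrite !tilde_poly_horner rmorphM hornerM. Qed.

Lemma tilde_polyB p q : tilde_poly (p - q) = tilde_poly p - tilde_poly q.
Proof. by rewrite !tilde_poly_horner rmorphB hornerD hornerN. Qed.

Lemma tofracXn_neq0 N : ('X^N : {poly C})%:F != 0.
Proof. by rewrite tofrac_eq0 expf_neq0 // polyX_eq0. Qed.

Lemma tilde_poly_eq0 p : (tilde_poly p == 0) = (p == 0).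
Proof.
rewrite (tilde_polyE (leqnSn (size p))) mulf_eq0 invr_eq0.
by rewrite (negPf (tofracXn_neq0 _)) orbF tofrac_eq0 (star_eq0 (leqnSn _)).
Qed.

(** [tilde] is defined on the canonical reduced fraction; cross-multiplication and multiplicativity
    of [tilde_poly] free it from that choice. *)
Lemma tilde_frac p q : q != 0 -> tilde (p%:F / q%:F) = tilde_poly p / tilde_poly q.
Proof.
move=> q0; set f := _ / _; have [d0 _ fE] := rnum_rdenP f.
have E : rnum f * q = p * rden f.
  by apply/eqP; rewrite -eqr_frac // -fE.
by apply/eqP; rewrite /tilde eqr_div ?tilde_poly_eq0 // -!tilde_polyM E.
Qed.

Lemma tilde_star N p q : q != 0 -> (size p <= N.+1)%N -> (size q <= N.+1)%N ->
  tilde (p%:F / q%:F) = (star N p)%:F / (star N q)%:F.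
Proof.
move=> q0 sp sq; rewrite tilde_frac // (tilde_polyE sp) (tilde_polyE sq).
by rewrite invf_div mulrA divfK ?tofracXn_neq0.
Qed.

Lemma tildeK : involutive (@tilde C).
Proof.
move=> f; have [p [q [q0 ->]]] := ratfunP f.
pose N := maxn (size p) (size q).
have sp : (size p <= N.+1)%N by rewrite leqW // leq_maxl.
have sq : (size q <= N.+1)%N by rewrite leqW // leq_maxr.
by rewrite (tilde_star q0 sp sq) (@tilde_star N) ?star_eq0 ?size_star ?starK.
Qed.

Lemma tilde_is_zmod_morphism : zmod_morphism (@tilde C).
Proof.
move=> f g; have [p [q [q0 ->]]] := ratfunP f; have [p' [q' [q'0 ->]]] := ratfunP g.
rewrite (tilde_frac p q0) (tilde_frac p' q'0) -!mulNr -rmorphN.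
rewrite !addf_div ?tofrac_eq0 ?tilde_poly_eq0 // -!rmorphM -rmorphD /= tilde_frac ?mulf_neq0 //.
by rewrite mulNr tilde_polyB !tilde_polyM mulNr.
Qed.

Lemma tilde_is_monoid_morphism : monoid_morphism (@tilde C).
Proof.
split=> [|f g].
  have -> : 1 = (1 : {poly C})%:F / 1%:F by rewrite rmorph1 divr1.
  by rewrite tilde_frac ?oner_neq0 // divff ?tilde_poly_eq0 ?oner_neq0 // rmorph1 divr1.
have [p [q [q0 ->]]] := ratfunP f; have [p' [q' [q'0 ->]]] := ratfunP g.
rewrite (tilde_frac p q0) (tilde_frac p' q'0) !mulf_div -!rmorphM /=.
by rewrite tilde_frac ?mulf_neq0 // !tilde_polyM.
Qed.

HB.instance Definition _ :=
  GRing.isZmodMorphism.Build (ratfun C) (ratfun C) (@tilde C) tilde_is_zmod_morphism.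
HB.instance Definition _ :=
  GRing.isMonoidMorphism.Build (ratfun C) (ratfun C) (@tilde C) tilde_is_monoid_morphism.

Lemma circle_inv a : `|a| = 1 -> a != 0 /\ (a^*)^-1 = a.
Proof.
move=> a1; have a0 : a != 0 by rewrite -normr_eq0 a1 oner_neq0.
by split=> //; rewrite invC_norm norm_conjC a1 conjCK expr1n invr1 mul1r.
Qed.

Lemma takes_tilde f a c : `|a| = 1 -> takes f a c -> takes (tilde f) a c^*.
Proof.
move=> /circle_inv[a0 aE] [npole <-]; rewrite -{2}aE; apply: reval_tilde => //.
by rewrite aE.
Qed.

Lemma sum_tilde_common n (f : 'I_n -> ratfun C) (g : 'I_n -> {poly C}) (d : {poly C}) N :
    d != 0 -> (size d <= N.+1)%N -> (forall i, size (g i) <= N.+1)%N ->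
    (forall i, f i = (g i)%:F / d%:F) ->
  \sum_i f i * tilde (f i) = (\sum_i g i * star N (g i))%:F / (d * star N d)%:F.
Proof.
move=> d0 sd sg fE; rewrite rmorph_sum /= mulr_suml; apply: eq_bigr => i _.
by rewrite fE (tilde_star d0 (sg i) sd) mulf_div !rmorphM.
Qed.

Lemma size_common n (g : 'I_n -> {poly C}) (d : {poly C}) : exists N,
  (size d <= N.+1)%N /\ forall i, (size (g i) <= N.+1)%N.
Proof.
exists (maxn (size d) (\max_i size (g i))); split; first by rewrite leqW ?leq_maxl.
by move=> i; rewrite leqW // leq_max leq_bigmax orbT.
Qed.

(** Definiteness of the form sending f to the sum of the f_i f_i~. It leaves the homogeneous linear
    system below with only the zero solution. *)
Lemma sum_tilde_eq0 n (f : 'I_n -> ratfun C) :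
  \sum_i f i * tilde (f i) = 0 -> forall i, f i = 0.
Proof.
have [d [g [d0 fE]]] := common_denominator f.
have [N [sd sg]] := size_common g d.
move=> /eqP; rewrite (sum_tilde_common d0 sd sg fE) mulf_eq0 invr_eq0 !tofrac_eq0.
rewrite mulf_eq0 star_eq0 // (negPf d0) !orbF => /eqP/polyP/(_ N).
(* the constant Laurent coefficient is the sum of all |g_i,l|^2 *)
rewrite coef_sum coef0.
have -> : \sum_i (g i * star N (g i))`_N = \sum_i \sum_(l < N.+1) `|(g i)`_l| ^+ 2.
  apply: eq_bigr => i _; rewrite coefM; apply: eq_bigr => l _.
  have lN : (l <= N)%N by rewrite -ltnS.
  by rewrite coef_star leq_subr subKn // normCK.
have ge0 i : true -> 0 <= \sum_(l < N.+1) `|(g i)`_l| ^+ 2.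
  by move=> _; apply: sumr_ge0 => l _; rewrite exprn_ge0.
move=> /(psumr_eq0P ge0) H i; rewrite fE.
suff -> : g i = 0 by rewrite rmorph0 mul0r.
apply/polyP => l; rewrite coef0; case: (ltnP l N.+1) => lN; last first.
  by rewrite nth_default // (leq_trans (sg i)).
have ge0' l' : true -> 0 <= `|(g i)`_l'| ^+ 2 by rewrite exprn_ge0.
have /(_ (Ordinal lN) isT)/= := psumr_eq0P (fun (l : 'I_N.+1) => @ge0' l) (H i isT).
by move/eqP; rewrite expf_eq0 normr_eq0 => /eqP.
Qed.

(** If the common denominator d vanishes at a, the cleared identity at a says that the sum of the
    |g_i(a)|^2 is zero; all numerators then vanish at a and X - a cancels. Induction on the size of
    d removes every such factor. *)
Lemma sum_tilde_regular n (f : 'I_n -> ratfun C) a :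
  \sum_i f i * tilde (f i) = 1 -> `|a| = 1 -> forall i, ~~ pole (f i) a.
Proof.
move=> f1 a1; have [a0 aE] := circle_inv a1.
have [d [g [d0 fE]]] := common_denominator f.
have [b] := ubnP (size d); elim: b d g d0 fE => // b IH d g d0 fE db.
have [da|da] := eqVneq d.[a] 0; last first.
  by move=> i; rewrite fE; case: (reval_frac (g i) da).
have [N [sd sg]] := size_common g d.
have ga i : (g i).[a] = 0.
  have: \sum_i g i * star N (g i) = d * star N d.
    have dd0 : (d * star N d)%:F != 0 by rewrite tofrac_eq0 mulf_neq0 ?star_eq0.
    apply/eqP; rewrite -tofrac_eq -(inj_eq (mulIf (invr_neq0 dd0))).
    by rewrite -(sum_tilde_common d0 sd sg fE) f1 divff.
  move/(congr1 (horner^~ a)); rewrite hornerM da mul0r horner_sum.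
  have -> : \sum_i (g i * star N (g i)).[a] = a ^+ N * \sum_i `|(g i).[a]| ^+ 2.
    rewrite mulr_sumr; apply: eq_bigr => l _.
    by rewrite hornerM /star horner_conj_rev // aE normCK mulrCA.
  move/eqP; rewrite mulf_eq0 expf_eq0 (negPf a0) andbF /= => /eqP H.
  have ge0 l : true -> 0 <= `|(g l).[a]| ^+ 2 by rewrite exprn_ge0.
  have /eqP := psumr_eq0P ge0 H (erefl true) (i := i).
  by rewrite expf_eq0 normr_eq0 => /eqP.
have Xa0 : 'X - a%:P != 0 by rewrite polyXsubC_eq0.
have [d' dE] : exists d', d = d' * ('X - a%:P).
  by apply/factor_theorem/eqP.
have d'0 : d' != 0 by apply: contraNneq d0 => E; rewrite dE E mul0r.
apply: (IH d' (fun i => g i %/ ('X - a%:P))) => // [i|].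
  rewrite fE; apply/eqP; rewrite eqr_frac // dE mulrCA divpK 1?mulrC //.
  by rewrite dvdp_XsubCl; apply/eqP.
by move: db; rewrite dE size_Mmonic ?monicXsubC // size_XsubC addn2 /= ltnS.
Qed.

End Reversal.

(** * Good matrices *)

Section Regularity.
Variable C : numClosedFieldType.
Implicit Types (f g : ratfun C) (a c : C).

(** A form of Liouville's theorem. Reflection in the circle turns regularity of [tilde f] in the
    disk into regularity of f outside it; the field being algebraically closed, f is a
    polynomial. *)
Lemma const_of_regular f :
  (forall a, `|a| <= 1 -> ~~ pole f a) -> Rplus (tilde f) -> exists c, f = c%:P%:F.
Proof.
move=> fD tfD; have [d0 cop fE] := rnum_rdenP f.
have nopole a : ~~ pole f a.
  have [/fD //|a1] := real_leP (normr_real a) (@real1 C).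
  have a0 : a != 0 by rewrite -normr_eq0 gt_eqF // (lt_trans ltr01).
  rewrite -[f]tildeK; apply: (reval_tilde a0 _).1; apply: tfD.
  by rewrite normfV norm_conjC invf_lt1 // (lt_trans ltr01).
have [dc|] := boolP (size (rden f) != 1).
  by have /closed_rootP[a ra] := dc; have := nopole a; rewrite /pole ra.
rewrite negbK => /size_poly1P[c c0 dE].
pose p := c^-1 *: rnum f.
have fp : f = p%:F.
  by rewrite fE dE /p -mul_polyC rmorphM mulrC; congr (_ * _);
     apply: (mulfI (_ : c%:P%:F != 0));
     rewrite ?tofrac_eq0 ?polyC_eq0 // divff -?rmorphM -?polyCM ?divff ?rmorph1 // tofrac_eq0 polyC_eq0.
have [p0|pn0] := eqVneq p 0; first by exists 0; rewrite fp p0.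
have sp : size p = (size p).-1.+1 by rewrite prednK // lt0n size_poly_eq0.
(* The point 0 is the reflection of infinity: for p of degree N, the tilde of p has denominator X^N
   in lowest terms, hence a pole at 0 unless N = 0. *)
have: ~~ pole (tilde (p%:F / 1%:F)) 0 by rewrite rmorph1 divr1 -fp; apply: tfD; rewrite normr0.
set N := (size p).-1 in sp *.
have sp' : (size p <= N.+1)%N by rewrite sp.
rewrite (@tilde_star _ N) ?oner_neq0 // ?size_poly1 //.
rewrite (@pole_reduced _ _ (star N p) (star N 1)); last first.
  split=> //; first by rewrite star_eq0 ?oner_neq0 // size_poly1.
  have -> : star N 1 = 'X^N :> {poly C}.
    rewrite /star big_ord_recl coef1 /= conjC1 scale1r subn0 big1 ?addr0 // => i _.
    by rewrite coef1 conjC0 scale0r.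
  rewrite coprimep_sym coprimep_expl // coprimep_sym coprimepX.
  exact: root_star0.
rewrite /root horner_coef0 coef_star coef1 subn0 /=.
have [N0 _|N0] := eqVneq N 0; last by rewrite conjC0 eqxx.
by exists p`_0; rewrite fp {1}[p]size1_polyC // sp N0.
Qed.

Lemma mx_value_reval m n (A : 'M[ratfun C]_(m, n)) a :
  (forall i j, ~~ pole (A i j) a) -> mx_value_at A a (\matrix_(i, j) reval (A i j) a).
Proof. by move=> Aa i j; rewrite mxE. Qed.

Lemma mx_value_mulmx m n r (A : 'M[ratfun C]_(m, n)) (B : 'M[ratfun C]_(n, r)) a A' B' :
  mx_value_at A a A' -> mx_value_at B a B' -> mx_value_at (A *m B) a (A' *m B').
Proof.
move=> hA hB i j; rewrite !mxE; apply: takes_sum => l.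
by apply: takesM; [apply: hA | apply: hB].
Qed.

Lemma mx_value_tilde m n (A : 'M[ratfun C]_(m, n)) a A' :
  `|a| = 1 -> mx_value_at A a A' -> mx_value_at (tilde_mx A) a (map_mx Num.conj A')^T.
Proof. by move=> a1 hA i j; rewrite !mxE; apply: takes_tilde => //; apply: hA. Qed.

Lemma takes_sign n a : takes ((-1) ^+ n) a ((-1) ^+ n).
Proof.
have -> : (-1) ^+ n = ((-1) ^+ n : C)%:P%:F by rewrite !rmorphXn !rmorphN !rmorph1.
exact: takesC.
Qed.

Lemma takes_det n (A : 'M[ratfun C]_n) a A' :
  mx_value_at A a A' -> takes (\det A) a (\det A').
Proof.
move=> hA; rewrite /determinant; elim/big_ind2: _ => [|f c g d|s _].
- by rewrite -(rmorph0 (@FracField.tofrac {poly C})) -polyC0; apply: takesC.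
- exact: takesD.
apply: takesM; first exact: takes_sign.
elim/big_ind2: _ => [|f c g d|i _]; last exact: hA; last exact: takesM.
by rewrite -(rmorph1 (@FracField.tofrac {poly C})) -polyC1; apply: takesC.
Qed.

Definition mx_Rplus m n (A : 'M[ratfun C]_(m, n)) : Prop := forall i j, Rplus (A i j).

Lemma mx_Rplus_mulmx m n r (A : 'M[ratfun C]_(m, n)) (B : 'M[ratfun C]_(n, r)) :
  mx_Rplus A -> mx_Rplus B -> mx_Rplus (A *m B).
Proof.
move=> hA hB i j a a1.
have hAa : forall i j, ~~ pole (A i j) a by move=> i' j'; apply: hA.
have hBa : forall i j, ~~ pole (B i j) a by move=> i' j'; apply: hB.
exact: (mx_value_mulmx (mx_value_reval hAa) (mx_value_reval hBa) i j).1.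
Qed.

Lemma Rplus_det n (A : 'M[ratfun C]_n) : mx_Rplus A -> Rplus (\det A).
Proof.
move=> hA a a1.
have hAa : forall i j, ~~ pole (A i j) a by move=> i' j'; apply: hA.
exact: (takes_det (mx_value_reval hAa)).1.
Qed.

Lemma mx_Rplus_adj n (A : 'M[ratfun C]_n) : mx_Rplus A -> mx_Rplus (\adj A).
Proof.
move=> hA i j; rewrite mxE /cofactor; set M := row' _ _.
have hM : Rplus (\det M) by apply: Rplus_det => i' j'; rewrite !mxE; apply: hA.
by move=> a a1; apply: (takesM (takes_sign _ a) (nopole_takes (hM a a1))).1.
Qed.

Lemma tilde_mxE m n (A : 'M[ratfun C]_(m, n)) : tilde_mx A = (map_mx (@tilde C) A)^T.
Proof. by apply/matrixP => i j; rewrite !mxE. Qed.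

Lemma tilde_mxM m n r (A : 'M[ratfun C]_(m, n)) (B : 'M[ratfun C]_(n, r)) :
  tilde_mx (A *m B) = tilde_mx B *m tilde_mx A.
Proof. by rewrite !tilde_mxE map_mxM trmx_mul. Qed.

Lemma tilde_mxK m n (A : 'M[ratfun C]_(m, n)) : tilde_mx (tilde_mx A) = A.
Proof. by apply/matrixP => i j; rewrite !mxE tildeK. Qed.

Lemma det_tilde_mx n (A : 'M[ratfun C]_n) : \det (tilde_mx A) = tilde (\det A).
Proof. by rewrite tilde_mxE det_tr det_map_mx. Qed.

Section Row.
Variables (k : nat) (phi : 'rV[ratfun C]_k).

Lemma Fmx_mulN : Fmx (- phi) *m Fmx phi = 1%:M.
Proof.
rewrite /Fmx mulmx_block !(mul1mx, mulmx1, mul0mx, mulmx0, addr0, add0r) addNr.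
by rewrite -scalar_mx_block.
Qed.

Lemma det_Fmx (psi : 'rV[ratfun C]_k) : \det (Fmx psi) = 1.
Proof. by rewrite /Fmx det_lblock !det1 mulr1. Qed.

(** [Fmx (- phi)] is the inverse of [Fmx phi]. The number of columns is free, so that the notion
    covers both a factor U and a single column solving the homogeneous system. *)
Definition good n (U : 'M[ratfun C]_(k + 1, n)) : Prop :=
  [/\ mx_Rplus (Fmx phi *m U), mx_Rplus (tilde_mx U *m Fmx (- phi))
    & forall i j a, `|a| = 1 -> ~~ pole (U i j) a].

(* Each product of a tilded column with a column factors through F^-1 F, so it
   lies in R_+, and so does its tilde; being regular on the circle as well, it
   has no poles at all on the sphere. *)
Lemma good_mul n r (U : 'M[ratfun C]_(k + 1, n)) (V : 'M[ratfun C]_(k + 1, r)) A B :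
    good U -> good V -> mx_value_at U 1 A -> mx_value_at V 1 B ->
  tilde_mx U *m V = map_mx (fun c => c%:P%:F) ((map_mx Num.conj A)^T *m B).
Proof.
move=> gU gV UA VB; have [FU UF Ureg] := gU; have [FV VF Vreg] := gV.
have prod_plus n' r' (X : 'M_(_, n')) (Y : 'M_(_, r')) :
    mx_Rplus (tilde_mx X *m Fmx (- phi)) -> mx_Rplus (Fmx phi *m Y) ->
    mx_Rplus (tilde_mx X *m Y).
  move=> hX hY; rewrite -[Y]mul1mx -Fmx_mulN -(mulmxA (Fmx _)) (mulmxA (tilde_mx X)).
  exact: (mx_Rplus_mulmx hX hY).
have val a : `|a| = 1 -> forall i j, ~~ pole ((tilde_mx U *m V) i j) a.
  move=> a1 i j.
  have Ua : forall i j, ~~ pole (U i j) a by move=> *; apply: Ureg.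
  have Va : forall i j, ~~ pole (V i j) a by move=> *; apply: Vreg.
  exact: (mx_value_mulmx (mx_value_tilde a1 (mx_value_reval Ua)) (mx_value_reval Va) i j).1.
apply/matrixP => i j; rewrite [RHS]mxE.
have [||c cE] := @const_of_regular ((tilde_mx U *m V) i j).
- move=> a; rewrite le_eqVlt => /orP[/eqP a1|]; first exact: val.
  exact: (prod_plus _ _ _ _ UF FV).
- have -> : tilde ((tilde_mx U *m V) i j) = (tilde_mx V *m U) j i.
    by rewrite -[tilde_mx V *m U]tilde_mxK tilde_mxM tilde_mxK [RHS]mxE.
  exact: (prod_plus _ _ _ _ VF FU).
rewrite cE; congr (@FracField.tofrac _ _%:P).
apply: takes_inj (takesC c 1) _; rewrite -cE.
exact: (mx_value_mulmx (mx_value_tilde (normr1 C) UA) VB i j).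
Qed.

(** For paraunitary U the matrix U~ F^-1 is the inverse of F U, which has determinant 1; it is
    therefore the adjugate of F U, whose cofactors are in R_+. Regularity on the circle comes from
    the diagonal of U U~ = I. *)
Lemma unitary_factor_good U : unitary_factor phi U -> good U.
Proof.
move=> [UU _ detU _ FU]; split=> // [|i j a a1].
  have detFU : \det (Fmx phi *m U) = 1 by rewrite det_mulmx det_Fmx detU mulr1.
  suff -> : tilde_mx U *m Fmx (- phi) = \adj (Fmx phi *m U) by apply: mx_Rplus_adj.
  rewrite -[LHS]mulmx1 -[1%:M]/(1%:M) -detFU -mul_mx_adj mulmxA mulmxA.
  rewrite -(mulmxA _ _ (Fmx phi)) Fmx_mulN mulmx1.
  by rewrite (mulmx1C UU) mul1mx.
have Ui : \sum_l U i l * tilde (U i l) = 1.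
  have /matrixP/(_ i i) := UU; rewrite !mxE eqxx => E; rewrite -[RHS]E.
  by apply: eq_bigr => l _; rewrite mxE.
exact: (sum_tilde_regular Ui).
Qed.

Lemma unitary_factor_unique U V : unitary_factor phi U -> unitary_factor phi V -> U = V.
Proof.
move=> hU hV; have := good_mul (unitary_factor_good hU) (unitary_factor_good hV)
  (uf_at1 hU) (uf_at1 hV).
rewrite map_mx1 trmx1 mulmx1 => UV.
have {}UV : tilde_mx U *m V = 1%:M.
  rewrite UV; apply/matrixP => i j; rewrite !mxE.
  by case: (i == j); rewrite ?rmorph1 ?rmorph0.
by rewrite -[V]mul1mx -(uf_paraunitary hU) -mulmxA UV mulmx1.
Qed.

Lemma good_unitary_factor U : good U -> mx_value_at U 1 1%:M -> unitary_factor phi U.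
Proof.
move=> gU U1; have [FU UF Ureg] := gU.
have UU : tilde_mx U *m U = 1%:M.
  rewrite (good_mul gU gU U1 U1) map_mx1 trmx1 mulmx1; apply/matrixP => i j.
  by rewrite !mxE; case: (i == j); rewrite ?rmorph1 ?rmorph0.
have detFU : \det U = \det (Fmx phi *m U) by rewrite det_mulmx det_Fmx mul1r.
split=> //; first exact: mulmx1C.
(* The upper rows of U are those of F U, and the last column of U~ F^-1 is the tilde of the last row
   of U. *)
- exists (col_mx (usubmx U) (map_mx (@tilde C) (dsubmx U))).
    move=> i j; move: (FU i j) (UF j i).
    move: (usubmx U) (dsubmx U) (vsubmxK U) => Uu Ud <-.
    rewrite -(splitK i); case: (split i) => l /=.
      by rewrite !col_mxEu /Fmx mul_block_col mul1mx mul0mx addr0 col_mxEu.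
    rewrite col_mxEd tilde_mxE map_col_mx tr_col_mx /Fmx mul_row_block.
    by rewrite !mulmx1 mulmx0 add0r row_mxEr !mxE => ?.
  rewrite col_mxKu col_mxKd -map_mx_comp -[LHS]vsubmxK; congr col_mx.
  by apply/matrixP => i j; rewrite [RHS]mxE /= tildeK.
(* The determinant equals that of F U and its tilde equals that of U~ F^-1, so it is constant, with
   the value taken at 1. *)
- have [||c cE] := @const_of_regular (\det U).
  + move=> a; rewrite le_eqVlt => /orP[/eqP a1|a1].
      have Ua : forall i j, ~~ pole (U i j) a by move=> *; apply: Ureg.
      exact: (takes_det (mx_value_reval Ua)).1.
    by rewrite detFU; apply: Rplus_det.
  + rewrite -det_tilde_mx -[\det _]mulr1 -(det_Fmx (- phi)) -det_mulmx.
    exact: Rplus_det.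
  rewrite cE; have := takes_det U1; rewrite det1 cE => /(takes_inj (takesC c 1)) ->.
  by rewrite rmorph1.
Qed.

End Row.
End Regularity.

(** * The linear system *)

Lemma frac_mul_cancel (F : fieldType) (p q a s : F) :
  q != 0 -> s != 0 -> p / q * (a / s) * (q * s) = p * a.
Proof. by move=> q0 s0; rewrite mulf_div divfK // mulf_neq0. Qed.

Lemma frac_sub_eq (F : fieldType) (p q r s a b : F) : q != 0 -> s != 0 ->
  p * r - q * a = s * b -> a / s - r / q * (p / s) = - (b / q).
Proof.
move=> q0 s0 E; apply: (mulIf (mulf_neq0 q0 s0)).
rewrite mulrBl (frac_mul_cancel _ _ q0 s0) mulNr [in RHS]mulrA (divfK q0).
by rewrite mulrCA (divfK s0) [b * s]mulrC -E opprB [r * p]mulrC.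
Qed.

Section LinearSystem.
Variables (C : numClosedFieldType) (k N : nat) (p : 'I_k -> {poly C}) (q : {poly C}).

Let M := (N.+1 + N)%N.

(** For q of degree N with its roots in the open disk, [star N q] has its roots outside the closed
    disk: the first k entries are in R_+, and the last one has its tilde in R_+. *)
Definition entry_den (y : 'I_(k + 1)) : {poly C} :=
  if split y is inl _ then star N q else q.

(** Applied to the numerators, row i < k must be divisible by [star N q], which puts column i of U~
    F^-1 in R_+; the last row must be divisible by q, which puts the last row of F U in R_+. *)
Definition system_coef : 'M[{poly C}]_(k + 1) :=
  block_mx (- q)%:M (\col_i star N (p i)) (\row_i p i) (star N q)%:M.

(* Row y of an unknown matrix holds the coefficients of two polynomials: the
   numerator of the y-th entry of a column of U, and a quotient by entry_den y. *)
Implicit Types x : 'M[C]_(k + 1, N.+1 + N.+1).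

Definition entry_num x y : {poly C} := rVpoly (lsubmx (row y x)).
Definition entry_quo x y : {poly C} := rVpoly (rsubmx (row y x)).

Definition residual x y : {poly C} :=
  \sum_z system_coef y z * entry_num x z - entry_den y * entry_quo x y.

(* The coefficients of the residual have index below M, so index M is free to
   hold the value at 1 of the numerator; this makes the system square. *)
Definition system x : 'M[C]_(k + 1, N.+1 + N.+1) :=
  \matrix_(y, l) (residual x y + (entry_num x y).[1] *: 'X^M)`_l.

(** Zero residuals and, at index M, the numerator values that make the j-th column of U(1) the j-th
    unit vector. *)
Definition system_rhs (j : 'I_(k + 1)) : 'M[C]_(k + 1, N.+1 + N.+1) :=
  \matrix_(y, l) (((y == j)%:R * (entry_den y).[1]) *: 'X^M)`_l.

Definition solution j : 'M[C]_(k + 1, N.+1 + N.+1) :=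
  vec_mx (mxvec (system_rhs j) *m invmx (lin_mx system)).

Definition solution_mx : 'M[ratfun C]_(k + 1) :=
  \matrix_(y, j) ((entry_num (solution j) y)%:F / (entry_den y)%:F).

Lemma entry_num_is_linear y : linear (entry_num ^~ y).
Proof. by move=> c u v; rewrite /entry_num; do 3 rewrite linearP /=. Qed.

Lemma entry_quo_is_linear y : linear (entry_quo ^~ y).
Proof. by move=> c u v; rewrite /entry_quo; do 3 rewrite linearP /=. Qed.

Lemma residual_is_linear y : linear (residual ^~ y).
Proof.
move=> c u v; rewrite /residual entry_quo_is_linear scalerBr scaler_sumr.
rewrite mulrDr scalerAr opprD addrACA; congr (_ + _); rewrite -big_split /=.
by apply: eq_bigr => z _; rewrite entry_num_is_linear mulrDr scalerAr.
Qed.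

Lemma system_is_linear : linear system.
Proof.
move=> c u v; apply/matrixP => y l; rewrite !mxE residual_is_linear.
rewrite entry_num_is_linear hornerD hornerZ scalerDl -scalerA addrACA -scalerDr.
by rewrite -coefZ -coefD.
Qed.

HB.instance Definition _ :=
  GRing.isLinear.Build C _ _ _ system system_is_linear.

Hypotheses (sq : size q = N.+1) (sp : forall i, (size (p i) <= N.+1)%N).

Lemma size_entry_num x y : (size (entry_num x y) <= N.+1)%N.
Proof. exact: size_poly. Qed.

Lemma size_entry_quo x y : (size (entry_quo x y) <= N.+1)%N.
Proof. exact: size_poly. Qed.

Lemma size_entry_den y : (size (entry_den y) <= N.+1)%N.
Proof. by rewrite /entry_den; case: (split y) => _; rewrite ?size_star // sq. Qed.

Lemma size_residual x y : (size (residual x y) <= M)%N.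
Proof.
have sM (a b : {poly C}) : (size a <= N.+1)%N -> (size b <= N.+1)%N ->
    (size (a * b)%R <= M)%N.
  move=> sa sb; apply: leq_trans (size_polyMleq _ _) _.
  by rewrite /M -subn1 leq_subLR add1n -addnS leq_add.
rewrite (leq_trans (size_polyD _ _)) // geq_max size_polyN.
rewrite sM ?size_entry_den ?size_entry_quo // andbT.
rewrite (leq_trans (size_sum _ _ _)) //; apply/bigmax_leqP => z _.
rewrite sM ?size_entry_num // /system_coef.
rewrite -(splitK y) -(splitK z); case: (split y) => i; case: (split z) => l /=.
- by rewrite block_mxEul mxE; case: (i == l); rewrite ?mulr1n ?mulr0n ?size_polyN ?sq ?size_poly0.
- by rewrite block_mxEur mxE size_star.
- by rewrite block_mxEdl mxE.
- by rewrite block_mxEdr mxE; case: (i == l); rewrite ?mulr1n ?mulr0n ?size_star ?size_poly0.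
Qed.

Lemma system_solved x (c : 'I_(k + 1) -> C) :
    (forall y l, system x y l = (c y *: 'X^M)`_l) ->
  forall y, residual x y = 0 /\ (entry_num x y).[1] = c y.
Proof.
move=> H y; have sr := size_residual x y.
have El l : (l <= M)%N ->
    (residual x y)`_l + (entry_num x y).[1] * (l == M)%:R = c y * (l == M)%:R.
  (* M = 2N + 1 is the last column index, one above the degree 2N that a residual can reach. *)
  move=> lM; have lM' : (l < N.+1 + N.+1)%N by rewrite addnS ltnS.
  by have := H y (Ordinal lM'); rewrite mxE coefD !coefZ coefXn.
split; last first.
  by have := El M (leqnn M); rewrite eqxx !mulr1 nth_default // add0r.
apply/polyP => l; rewrite coef0; case: (ltnP l M) => lM; last first.
  by rewrite nth_default // (leq_trans sr).
by have := El l (ltnW lM); rewrite (ltn_eqF lM) !mulr0 addr0.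
Qed.

Lemma residual_lshift x i : residual x (lshift 1 i) =
  star N (p i) * entry_num x (rshift k ord0) - q * entry_num x (lshift 1 i)
  - star N q * entry_quo x (lshift 1 i).
Proof.
rewrite /residual /entry_den (unsplitK (inl i)); congr (_ - _).
rewrite big_split_ord big_ord1 /system_coef block_mxEur mxE addrC; congr (_ + _).
rewrite (bigD1 i) //= block_mxEul mxE eqxx mulr1n big1 ?addr0 ?mulNr // => l li.
by rewrite block_mxEul mxE eq_sym (negPf li) mulr0n mul0r.
Qed.

Lemma residual_rshift x : residual x (rshift k ord0) =
  \sum_i p i * entry_num x (lshift 1 i) + star N q * entry_num x (rshift k ord0)
  - q * entry_quo x (rshift k ord0).
Proof.
rewrite /residual /entry_den (unsplitK (inr ord0)); congr (_ - _).
rewrite big_split_ord big_ord1 /system_coef block_mxEdr mxE eqxx mulr1n.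
by congr (_ + _); apply: eq_bigr => l _; rewrite block_mxEdl mxE.
Qed.

Hypothesis q_disk : forall a, root q a -> `|a| < 1.

Let q0 : q != 0. Proof. by rewrite -size_poly_eq0 sq. Qed.
Let sq' : (size q <= N.+1)%N. Proof. by rewrite sq. Qed.
Let qs0 : star N q != 0. Proof. by rewrite star_eq0. Qed.

(** Reflection exchanges the roots of q with those of [star N q]; 0 is not among the latter because
    q has degree exactly N. *)
Lemma root_star_disk a : root (star N q) a -> 1 < `|a|.
Proof.
move=> ra; have a0 : a != 0 by apply: contraTneq ra => ->; apply: root_star0.
move: ra; rewrite root_star // => /q_disk; rewrite normfV norm_conjC.
by rewrite invf_lt1 // normr_gt0.
Qed.

Lemma entry_den_circle y a : `|a| = 1 -> (entry_den y).[a] != 0.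
Proof.
move=> a1; rewrite /entry_den; case: (split y) => _; apply/negP.
  by move=> /root_star_disk; rewrite a1 ltxx.
by move=> /q_disk; rewrite a1 ltxx.
Qed.

Lemma Rplus_star_den (r : {poly C}) : Rplus (r%:F / (star N q)%:F).
Proof.
move=> a a1; apply: (reval_frac r _).1; apply/negP => /root_star_disk.
by move/(lt_trans a1); rewrite ltxx.
Qed.

Lemma entry_den_neq0 y : entry_den y != 0.
Proof. by rewrite /entry_den; case: (split y). Qed.

Variable phi : 'rV[ratfun C]_k.
Hypothesis phiE : forall i, phi 0 i = (p i)%:F / q%:F.

(** Each vanishing residual cancels one factor of the denominator q [star N q]: directly in the last
    row of F U, and before applying tilde in the first k columns of U~ F^-1. What remains is a
    fraction over [star N q], hence in R_+. *)
Lemma residual_good n (x : 'I_n -> 'M[C]_(k + 1, N.+1 + N.+1)) :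
    (forall j y, residual (x j) y = 0) ->
  good phi (\matrix_(y, j) ((entry_num (x j) y)%:F / (entry_den y)%:F)).
Proof.
move=> x0; set U := \matrix_(_, _) _.
have Ul i j : U (lshift 1 i) j = (entry_num (x j) (lshift 1 i))%:F / (star N q)%:F.
  by rewrite mxE /entry_den (unsplitK (inl i)).
have Ur j : U (rshift k ord0) j = (entry_num (x j) (rshift k ord0))%:F / q%:F.
  by rewrite mxE /entry_den (unsplitK (inr ord0)).
have qF0 : q%:F != 0 by rewrite tofrac_eq0.
have qsF0 : (star N q)%:F != 0 by rewrite tofrac_eq0.
have FUr j : \sum_i phi 0 i * U (lshift 1 i) j + U (rshift k ord0) j =
    (entry_quo (x j) (rshift k ord0))%:F / (star N q)%:F.
  have /eqP := x0 j (rshift k ord0); rewrite residual_rshift subr_eq0 => /eqP E.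
  apply: (mulIf (mulf_neq0 qF0 qsF0)); rewrite [RHS]mulrCA divfK // -[in RHS]rmorphM -E.
  rewrite mulrDl rmorphD [X in _ = X + _]rmorph_sum mulr_suml; congr (_ + _).
    by apply: eq_bigr => i _; rewrite phiE Ul (frac_mul_cancel _ _ qF0 qsF0) -rmorphM.
  by rewrite Ur mulrA (divfK qF0) mulrC -rmorphM.
have tphi i : tilde (phi 0 i) = (star N (p i))%:F / (star N q)%:F.
  by rewrite phiE (tilde_star q0 (sp i) sq').
have UFl i j : tilde (U (lshift 1 i) j) - tilde (U (rshift k ord0) j) * phi 0 i =
    (- star N (entry_quo (x j) (lshift 1 i)))%:F / (star N q)%:F.
  (* The claim is the tilde of an identity with right-hand side over q, namely the vanishing
     residual divided by q [star N q]. *)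
  rewrite -[phi 0 i]tildeK -rmorphM -rmorphB tphi rmorphN mulNr.
  rewrite -(tilde_star q0 (size_entry_quo _ _) sq') -rmorphN; congr tilde.
  have /eqP := x0 j (lshift 1 i); rewrite residual_lshift subr_eq0 => /eqP E.
  rewrite Ul Ur; apply: (frac_sub_eq qF0 qsF0).
  by rewrite -!rmorphM -rmorphB E.
have Uud : U = col_mx (usubmx U) (dsubmx U) by rewrite vsubmxK.
split.
- move=> y j; rewrite Uud /Fmx mul_block_col !mul1mx mul0mx addr0.
  rewrite -(splitK y); case: (split y) => i /=.
    by rewrite col_mxEu mxE Ul; apply: Rplus_star_den.
  rewrite col_mxEd; set P := (phi *m _ + _).
  suff -> : P i j = (entry_quo (x j) (rshift k ord0))%:F / (star N q)%:F.
    exact: Rplus_star_den.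
  rewrite -FUr ord1 mxE; congr (_ + _); last by rewrite mxE.
  by rewrite mxE; apply: eq_bigr => l _; congr (_ * _); rewrite mxE.
- move=> j y; rewrite tilde_mxE Uud map_col_mx tr_col_mx /Fmx mul_row_block.
  rewrite !mulmx1 mulmx0 add0r mulmxN.
  rewrite -(splitK y); case: (split y) => i /=.
    rewrite row_mxEl; set P := (_ + - _).
    suff -> : P j i = tilde (U (lshift 1 i) j) - tilde (U (rshift k ord0) j) * phi 0 i.
      by rewrite UFl; apply: Rplus_star_den.
    rewrite mxE [X in _ + X]mxE [X in - X]mxE big_ord1; congr (_ - _ * _).
      by rewrite mxE [LHS]mxE; congr (tilde _); rewrite mxE.
    by rewrite mxE [LHS]mxE; congr (tilde _); rewrite mxE.
  rewrite row_mxEr ord1 mxE [X in Rplus X]mxE mxE Ur (tilde_star q0 (size_entry_num _ _) sq').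
  exact: Rplus_star_den.
- move=> y j a a1; rewrite mxE; apply: (reval_frac _ _).1.
  exact: entry_den_circle.
Qed.

Lemma solution_value n (x : 'I_n -> 'M[C]_(k + 1, N.+1 + N.+1)) :
  mx_value_at (\matrix_(y, j) ((entry_num (x j) y)%:F / (entry_den y)%:F)) 1
    (\matrix_(y, j) ((entry_num (x j) y).[1] / (entry_den y).[1])).
Proof.
move=> y j; rewrite !mxE; apply: reval_frac.
exact: entry_den_circle (normr1 C).
Qed.

Lemma system_inj x : system x = 0 -> x = 0.
Proof.
move=> x0; have H := @system_solved x (fun=> 0).
have {}H y : residual x y = 0 /\ (entry_num x y).[1] = 0.
  by apply: H => z l; rewrite x0 mxE scale0r coef0.
have gU := @residual_good 1 (fun=> x) (fun _ y => (H y).1).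
have U1 := @solution_value 1 (fun=> x).
have num0 y : entry_num x y = 0.
  (* X~ X is constant, with the value 0 that it takes at 1; definiteness then kills every
     numerator. *)
  have /matrixP/(_ 0 0) := good_mul gU gU U1 U1.
  have -> : \matrix_(y, j) ((entry_num x y).[1] / (entry_den y).[1]) =
      0 :> 'M_(k + 1, 1).
    by apply/matrixP => z j; rewrite !mxE (H z).2 mul0r.
  rewrite mulmx0 [RHS]mxE [X in _ = X%:P%:F]mxE !rmorph0 mxE => E.
  have {}E : \sum_l ((entry_num x l)%:F / (entry_den l)%:F) *
      tilde ((entry_num x l)%:F / (entry_den l)%:F) = 0.
    by rewrite -[RHS]E; apply: eq_bigr => l _; rewrite !mxE mulrC.
  have /eqP := sum_tilde_eq0 E y.
  by rewrite mulf_eq0 invr_eq0 !tofrac_eq0 (negPf (entry_den_neq0 y)) orbF => /eqP.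
have quo0 y : entry_quo x y = 0.
  have /eqP := (H y).1; rewrite /residual big1 => [|z _]; last by rewrite num0 mulr0.
  by rewrite sub0r oppr_eq0 mulf_eq0 (negPf (entry_den_neq0 y)) => /eqP.
apply/row_matrixP => y; rewrite row0 -[row y x]hsubmxK.
rewrite -[lsubmx _]rVpolyK -[rsubmx _]rVpolyK.
by rewrite -/(entry_num x y) -/(entry_quo x y) num0 quo0 !linear0 row_mx0.
Qed.

Lemma system_unit : lin_mx system \in unitmx.
Proof.
rewrite -row_free_unit; apply: inj_row_free => v.
rewrite -[v]vec_mxK mul_vec_lin => /eqP; rewrite mxvec_eq0 => /eqP /system_inj ->.
by rewrite linear0.
Qed.

Lemma solution_mx_unitary_factor : unitary_factor phi solution_mx.
Proof.
have H j y : residual (solution j) y = 0 /\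
    (entry_num (solution j) y).[1] = (y == j)%:R * (entry_den y).[1].
  apply: (@system_solved (solution j) (fun y => (y == j)%:R * (entry_den y).[1])).
  move=> z l; have -> : system (solution j) = system_rhs j; last by rewrite mxE.
  apply: (can_inj mxvecK); rewrite -mul_vec_lin /solution vec_mxK.
  by rewrite mulmxKV // system_unit.
apply: good_unitary_factor; first by apply: residual_good => j y; case: (H j y).
have -> : 1%:M = \matrix_(y, j) ((entry_num (solution j) y).[1] / (entry_den y).[1]).
  apply/matrixP => y j; rewrite !mxE (H j y).2 mulfK //.
  exact: entry_den_circle (normr1 C).
exact: solution_value.
Qed.

End LinearSystem.

(** * Computation trees *)

Section Computability.
Variables (C : numClosedFieldType) (V T : Type) (env : T -> V -> C).
Implicit Types (g h : T -> C) (f : T -> {poly C}).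

(** T is the type of inputs. One expression has to serve all of them, so nothing here branches on
    the data. *)
Definition expressible g : Prop := exists e : expr V, forall x, eval (env x) e = g x.

Lemma eq_expressible g h : g =1 h -> expressible g -> expressible h.
Proof. by move=> gh [e E]; exists e => x; rewrite E. Qed.

Lemma expressible_var v : expressible (fun x => env x v).
Proof. by exists (Var v). Qed.

Lemma expressible1 : expressible (fun=> 1).
Proof. by exists One. Qed.

Lemma expressibleN g : expressible g -> expressible (fun x => - g x).
Proof. by case=> e E; exists (Opp e) => x /=; rewrite E. Qed.

Lemma expressibleD g h :
  expressible g -> expressible h -> expressible (fun x => g x + h x).
Proof. by case=> e E [e' E']; exists (Add e e') => x /=; rewrite E E'. Qed.

Lemma expressibleM g h :
  expressible g -> expressible h -> expressible (fun x => g x * h x).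
Proof. by case=> e E [e' E']; exists (Mul e e') => x /=; rewrite E E'. Qed.

Lemma expressibleV g : expressible g -> expressible (fun x => (g x)^-1).
Proof. by case=> e E; exists (Inv e) => x /=; rewrite E. Qed.

Lemma expressible_conj g : expressible g -> expressible (fun x => (g x)^*).
Proof. by case=> e E; exists (Conj e) => x /=; rewrite E. Qed.

Lemma expressible0 : expressible (fun=> 0).
Proof. by exists (Add One (Opp One)) => x /=; rewrite subrr. Qed.

Lemma expressible_bool (b : bool) : expressible (fun=> b%:R).
Proof. by case: b; [apply: expressible1 | apply: expressible0]. Qed.

Lemma expressible_sum (I : Type) (r : seq I) (P : pred I) (G : I -> T -> C) :
  (forall i, expressible (G i)) -> expressible (fun x => \sum_(i <- r | P i) G i x).
Proof.
move=> HG; elim: r => [|i r IH].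
  by apply: eq_expressible expressible0 => x; rewrite big_nil.
case Pi: (P i).
  by apply: eq_expressible (expressibleD (HG i) IH) => x; rewrite big_cons Pi.
by apply: eq_expressible IH => x; rewrite big_cons Pi.
Qed.

Lemma expressible_prod (I : Type) (r : seq I) (P : pred I) (G : I -> T -> C) :
  (forall i, expressible (G i)) -> expressible (fun x => \prod_(i <- r | P i) G i x).
Proof.
move=> HG; elim: r => [|i r IH].
  by apply: eq_expressible expressible1 => x; rewrite big_nil.
case Pi: (P i).
  by apply: eq_expressible (expressibleM (HG i) IH) => x; rewrite big_cons Pi.
by apply: eq_expressible IH => x; rewrite big_cons Pi.
Qed.

Definition mx_expressible m n (A : T -> 'M[C]_(m, n)) : Prop :=
  forall i j, expressible (fun x => A x i j).

Lemma expressible_sign n : expressible (fun=> (-1) ^+ n).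
Proof.
rewrite -signr_odd; case: (odd n); rewrite ?expr0 ?expr1; last exact: expressible1.
exact: expressibleN expressible1.
Qed.

Lemma expressible_det n (A : T -> 'M[C]_n) :
  mx_expressible A -> expressible (fun x => \det (A x)).
Proof.
move=> hA; rewrite /determinant; apply: expressible_sum => s.
by apply: expressibleM; [apply: expressible_sign | apply: expressible_prod].
Qed.

(** Invertibility at every input makes [invmx] the cofactor formula throughout; one expression then
    suffices, without pivoting. *)
Lemma mx_expressible_inv n (A : T -> 'M[C]_n) :
  (forall x, A x \in unitmx) -> mx_expressible A -> mx_expressible (fun x => invmx (A x)).
Proof.
move=> uA hA i j.
apply: (@eq_expressible (fun x =>
  (\det (A x))^-1 * ((-1) ^+ (j + i) * \det (row' j (col' i (A x)))))).
  by move=> x; rewrite /invmx uA !mxE /cofactor.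
apply: expressibleM; first by apply: expressibleV; apply: expressible_det.
apply: expressibleM; first exact: expressible_sign.
apply: expressible_det => i' j'.
by apply: eq_expressible (hA (lift j i') (lift i j')) => x; rewrite !mxE.
Qed.

Lemma mx_expressible_mul m n r (A : T -> 'M[C]_(m, n)) (B : T -> 'M[C]_(n, r)) :
  mx_expressible A -> mx_expressible B -> mx_expressible (fun x => A x *m B x).
Proof.
move=> hA hB i j; apply: (@eq_expressible (fun x => \sum_l A x i l * B x l j)).
  by move=> x; rewrite mxE.
by apply: expressible_sum => l; apply: expressibleM.
Qed.

(** The uniform size bound lets finitely many coefficient expressions represent the polynomial at
    every input. *)
Definition poly_expressible f : Prop :=
  (exists n, forall x, (size (f x) <= n)%N) /\ forall i, expressible (fun x => (f x)`_i).

Lemma eq_poly_expressible f f' : f =1 f' -> poly_expressible f -> poly_expressible f'.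
Proof.
move=> E [[n fn] fi]; split; first by exists n => x; rewrite -E.
by move=> i; apply: eq_expressible (fi i) => x; rewrite E.
Qed.

Lemma poly_expressibleP f : poly_expressible f ->
  exists s : seq (expr V), forall x, eval_poly (env x) s = f x.
Proof.
move=> [[n fn] /choice[e E]]; exists (mkseq e n) => x; apply/polyP => i.
rewrite /eval_poly coef_Poly; case: (ltnP i n) => lin.
  by rewrite (nth_map One) ?size_mkseq // nth_mkseq.
have -> : (f x)`_i = 0 by apply: nth_default; apply: leq_trans (fn x) lin.
by apply: nth_default; rewrite size_map size_mkseq.
Qed.

Lemma poly_expressible_Xn n : poly_expressible (fun=> 'X^n).
Proof.
split; first by exists n.+1 => x; rewrite size_polyXn.
by move=> i; apply: eq_expressible (expressible_bool (i == n)) => x; rewrite coefXn.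
Qed.

Lemma poly_expressible0 : poly_expressible (fun=> 0).
Proof.
split; first by exists 0 => x; rewrite size_poly0.
by move=> i; apply: eq_expressible expressible0 => x; rewrite coef0.
Qed.

Lemma poly_expressible1 : poly_expressible (fun=> 1).
Proof. exact: (poly_expressible_Xn 0). Qed.

Lemma poly_expressibleN f : poly_expressible f -> poly_expressible (fun x => - f x).
Proof.
move=> [[n fn] fi]; split; first by exists n => x; rewrite size_polyN.
by move=> i; apply: eq_expressible (expressibleN (fi i)) => x; rewrite coefN.
Qed.

Lemma poly_expressibleD f f' : poly_expressible f -> poly_expressible f' ->
  poly_expressible (fun x => f x + f' x).
Proof.
move=> [[n fn] fi] [[n' fn'] fi']; split.
  exists (maxn n n') => x; rewrite (leq_trans (size_polyD _ _)) // geq_max.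
  by rewrite !leq_max fn fn' orbT.
by move=> i; apply: eq_expressible (expressibleD (fi i) (fi' i)) => x; rewrite coefD.
Qed.

Lemma poly_expressibleM f f' : poly_expressible f -> poly_expressible f' ->
  poly_expressible (fun x => f x * f' x).
Proof.
move=> [[n fn] fi] [[n' fn'] fi']; split.
  exists (n + n')%N => x; apply: leq_trans (size_polyMleq _ _) _.
  by rewrite (leq_trans (leq_pred _)) // leq_add.
move=> i; apply: (@eq_expressible (fun x => \sum_(j < i.+1) (f x)`_j * (f' x)`_(i - j))).
  by move=> x; rewrite coefM.
by apply: expressible_sum => j; apply: expressibleM.
Qed.

Lemma poly_expressibleZ g f : expressible g -> poly_expressible f ->
  poly_expressible (fun x => g x *: f x).
Proof.
move=> hg [[n fn] fi]; split.
  by exists n => x; rewrite (leq_trans (size_scale_leq _ _)).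
by move=> i; apply: eq_expressible (expressibleM hg (fi i)) => x; rewrite coefZ.
Qed.

Lemma poly_expressible_sum (I : Type) (r : seq I) (P : pred I) (G : I -> T -> {poly C}) :
  (forall i, poly_expressible (G i)) ->
  poly_expressible (fun x => \sum_(i <- r | P i) G i x).
Proof.
move=> HG; elim: r => [|i r IH].
  by apply: eq_poly_expressible poly_expressible0 => x; rewrite big_nil.
case Pi: (P i).
  by apply: eq_poly_expressible (poly_expressibleD (HG i) IH) => x; rewrite big_cons Pi.
by apply: eq_poly_expressible IH => x; rewrite big_cons Pi.
Qed.

Lemma poly_expressible_prod (I : Type) (r : seq I) (P : pred I) (G : I -> T -> {poly C}) :
  (forall i, poly_expressible (G i)) ->
  poly_expressible (fun x => \prod_(i <- r | P i) G i x).
Proof.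
move=> HG; elim: r => [|i r IH].
  by apply: eq_poly_expressible poly_expressible1 => x; rewrite big_nil.
case Pi: (P i).
  by apply: eq_poly_expressible (poly_expressibleM (HG i) IH) => x; rewrite big_cons Pi.
by apply: eq_poly_expressible IH => x; rewrite big_cons Pi.
Qed.

Lemma poly_expressible_star N f :
  poly_expressible f -> poly_expressible (fun x => star N (f x)).
Proof.
move=> [_ fi]; split; first by exists N.+1 => x; apply: size_star.
move=> i; have [iN|iN] := leqP i N; last first.
  by apply: eq_expressible expressible0 => x; rewrite coef_star leqNgt iN.
by apply: eq_expressible (expressible_conj (fi (N - i)%N)) => x; rewrite coef_star iN.
Qed.

Lemma expressible_horner1 f : poly_expressible f -> expressible (fun x => (f x).[1]).
Proof.
move=> [[n fn] fi]; apply: (@eq_expressible (fun x => \sum_(i < n) (f x)`_i)).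
  move=> x; rewrite (horner_coef_wide _ (fn x)).
  by apply: eq_bigr => i _; rewrite expr1n mulr1.
by apply: expressible_sum => i.
Qed.

Lemma poly_expressible_rVpoly d (v : T -> 'rV[C]_d) :
  mx_expressible v -> poly_expressible (fun x => rVpoly (v x)).
Proof.
move=> hv; split; first by exists d => x; apply: size_poly.
move=> i; case E: (insub i : option 'I_d) => [j|].
  by apply: eq_expressible (hv 0 j) => x; rewrite coef_rVpoly E.
by apply: eq_expressible expressible0 => x; rewrite coef_rVpoly E.
Qed.

(** * The linear system and its solution as expressions in the data *)

Section SystemExpressible.
Variables (k N : nat) (p : 'I_k -> T -> {poly C}) (q : T -> {poly C}).
Hypotheses (hp : forall i, poly_expressible (p i)) (hq : poly_expressible q).
Implicit Types X : T -> 'M[C]_(k + 1, N.+1 + N.+1).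

Lemma poly_expressible_entry_num X y : mx_expressible X ->
  poly_expressible (fun x => entry_num (X x) y).
Proof.
move=> hX; apply: poly_expressible_rVpoly => i j.
by apply: eq_expressible (hX y (lshift _ j)) => x; rewrite !mxE.
Qed.

Lemma poly_expressible_entry_quo X y : mx_expressible X ->
  poly_expressible (fun x => entry_quo (X x) y).
Proof.
move=> hX; apply: poly_expressible_rVpoly => i j.
by apply: eq_expressible (hX y (rshift _ j)) => x; rewrite !mxE.
Qed.

Lemma poly_expressible_entry_den (y : 'I_(k + 1)) :
  poly_expressible (fun x => entry_den N (q x) y).
Proof.
rewrite /entry_den; case: (split y) => _; last exact: hq.
exact: poly_expressible_star.
Qed.

Lemma poly_expressible_system_coef y z :
  poly_expressible (fun x => system_coef N (p ^~ x) (q x) y z).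
Proof.
rewrite /system_coef -(splitK y) -(splitK z).
case: (split y) => i; case: (split z) => j /=.
- apply: (@eq_poly_expressible (fun x => if i == j then - q x else 0)).
    by move=> x; rewrite block_mxEul mxE; case: (i == j).
  by case: (i == j); [apply: poly_expressibleN | apply: poly_expressible0].
- apply: eq_poly_expressible (poly_expressible_star N (hp i)) => x.
  by rewrite block_mxEur mxE.
- by apply: eq_poly_expressible (hp j) => x; rewrite block_mxEdl mxE.
- apply: (@eq_poly_expressible (fun x => if i == j then star N (q x) else 0)).
    by move=> x; rewrite block_mxEdr mxE; case: (i == j).
  by case: (i == j); [apply: poly_expressible_star | apply: poly_expressible0].
Qed.

Lemma mx_expressible_system X : mx_expressible X ->
  mx_expressible (fun x => system (p ^~ x) (q x) (X x)).
Proof.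
move=> hX y l.
apply: (@eq_expressible (fun x => (residual (p ^~ x) (q x) (X x) y +
    (entry_num (X x) y).[1] *: 'X^(N.+1 + N))`_l)); first by move=> x; rewrite mxE.
have hn z := poly_expressible_entry_num z hX.
apply: (_ : poly_expressible _).2; apply: poly_expressibleD; last first.
  apply: poly_expressibleZ; first exact: expressible_horner1.
  exact: poly_expressible_Xn.
apply: poly_expressibleD.
  apply: poly_expressible_sum => z.
  by apply: poly_expressibleM; first exact: poly_expressible_system_coef.
apply: poly_expressibleN; apply: poly_expressibleM.
  exact: poly_expressible_entry_den.
exact: poly_expressible_entry_quo.
Qed.

Hypothesis system_invertible : forall x, lin_mx (@system _ k N (p ^~ x) (q x)) \in unitmx.

Lemma mx_expressible_solution j :
  mx_expressible (fun x => solution N (p ^~ x) (q x) j).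
Proof.
move=> y l; rewrite /solution.
apply: (@eq_expressible (fun x => (mxvec (system_rhs N (q x) j) *m
    invmx (lin_mx (system (p ^~ x) (q x)))) 0 (mxvec_index y l))).
  by move=> x; rewrite [RHS]mxE.
apply: mx_expressible_mul => [i m|].
  rewrite ord1; case/mxvec_indexP: m => a b.
  apply: (@eq_expressible (fun x => (((a == j)%:R * (entry_den N (q x) a).[1]) *:
    'X^(N.+1 + N))`_b)); first by move=> x; rewrite mxvecE mxE.
  apply: (_ : poly_expressible _).2.
  apply: poly_expressibleZ; last exact: poly_expressible_Xn.
  apply: expressibleM; first exact: expressible_bool.
  exact: expressible_horner1 (poly_expressible_entry_den a).
apply: mx_expressible_inv => // m m'.
case/mxvec_indexP: m => a b; case/mxvec_indexP: m' => a' b'.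
(* The entries of the matrix of [system] are its values on the elementary matrices. *)
apply: (@eq_expressible (fun x => system (p ^~ x) (q x) (delta_mx a b) a' b')).
  by move=> x; rewrite /lin_mx [RHS]mxE /= vec_mx_delta mxvecE.
apply: mx_expressible_system => i i'.
apply: eq_expressible (expressible_bool ((i == a) && (i' == b))) => x.
by rewrite mxE.
Qed.

End SystemExpressible.

(** P records the outcomes of the tests made so far; the tree only has to be right on inputs that
    satisfy it. *)
Definition computable O (P : T -> Prop) (spec : T -> O -> Prop) : Prop :=
  exists t : tree V O, forall x, P x -> spec x (run (env x) t).

Lemma computable_ifzero O g P (spec : T -> O -> Prop) : expressible g ->
    computable (fun x => P x /\ g x = 0) spec ->
    computable (fun x => P x /\ g x != 0) spec ->
  computable P spec.
Proof.
move=> [e E] [t0 H0] [t1 H1]; exists (IfZero e t0 t1) => x Px /=; rewrite E.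
by have [g0|g0] := eqVneq (g x) 0; [apply: H0 | apply: H1].
Qed.

Fixpoint tree_bind O O' (t : tree V O) (F : O -> tree V O') : tree V O' :=
  match t with
  | Output o => F o
  | IfZero e t0 t1 => IfZero e (tree_bind t0 F) (tree_bind t1 F)
  end.

Lemma run_bind O O' (t : tree V O) (F : O -> tree V O') x :
  run (env x) (tree_bind t F) = run (env x) (F (run (env x) t)).
Proof. by elim: t => //= e t0 -> t1 ->; case: ifP. Qed.

(** The trees for the indices are chained by [tree_bind], each result being stored; [o0] fills the
    function before anything is computed. *)
Lemma computable_family (I : finType) O (o0 : O) P (spec : I -> T -> O -> Prop) :
  (forall i, computable P (spec i)) ->
  computable P (fun x (o : I -> O) => forall i, spec i x (o i)).
Proof.
move=> H; suff /(_ (enum I))[t Ht] (s : seq I) :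
    computable P (fun x (o : I -> O) => forall i, i \in s -> spec i x (o i)).
  by exists t => x Px i; apply: Ht; rewrite ?mem_enum.
elim: s => [|i s [ts Hs]]; first by exists (Output _ (fun=> o0)).
have [t Ht] := H i.
exists (tree_bind t (fun o => tree_bind ts (fun os =>
  Output _ (fun l => if l == i then o else os l)))) => x Px l.
rewrite !run_bind /= inE; have [->|_] := eqVneq l i; first by move=> _; apply: Ht.
exact: Hs.
Qed.

(** * Reduction to lowest terms by Euclid's algorithm *)

Section Reduction.
Variables (n d : T -> {poly C}).
Hypotheses (hn : poly_expressible n) (hd : poly_expressible d).
Hypothesis d_neq0 : forall x, d x != 0.

Definition reduces x (o : seq (expr V) * seq (expr V)) : Prop :=
  reduced ((n x)%:F / (d x)%:F) (eval_poly (env x) o.1) (eval_poly (env x) o.2).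

(** The relation u a + v b = 0 gives a/b = - v/u, and the constant determinant c is both a Bezout
    identity for u and v and the reason why u is nonzero. *)
Lemma bezout_reduced (a b s t u v : {poly C}) c : b != 0 -> c != 0 ->
  u * a + v * b = 0 -> s * v - t * u = c%:P -> reduced (a%:F / b%:F) (- v) u.
Proof.
move=> b0 c0 uv E; have u0 : u != 0.
  apply: contraNneq c0 => u0; move: uv E; rewrite u0 mul0r add0r => /eqP.
  rewrite mulf_eq0 (negPf b0) orbF => /eqP ->; rewrite !mulr0 subr0 => /esym/eqP.
  by rewrite polyC_eq0.
split=> //.
  apply/Bezout_coprimepP; exists (- s, - t) => /=.
  by rewrite mulrNN mulNr E -size_poly_eq1 size_polyC c0.
apply/eqP; rewrite eqr_frac // mulNr mulrC; apply/eqP/subr0_eq.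
by rewrite opprK -[RHS]uv.
Qed.

(* Euclid's algorithm, carrying only the cofactors of the two remainders; their
   determinant stays a nonzero constant, which at the end is a Bezout identity
   for the reduced fraction. *)
Lemma euclid a b s t u v (P : T -> Prop) :
    poly_expressible s -> poly_expressible t ->
    poly_expressible u -> poly_expressible v ->
    (forall x, P x -> [/\ (size (s x * n x + t x * d x)%R <= a)%N,
       (size (u x * n x + v x * d x)%R <= b)%N
       & exists2 c, c != 0 & s x * v x - t x * u x = c%:P]) ->
  computable P reduces.
Proof.
(* The induction is on the sum of the size bounds a and b, not on the sizes, which vary with the
   input. *)
have [m] := ubnP (a + b); elim: m => // m IH in a b s t u v P *.
(* Exchanging the two remainders only changes the sign of the determinant. *)
wlog ba : a b s t u v / (b <= a)%N.
  move=> W abm hs ht hu hv H; case/orP: (leq_total b a) => ba.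
    exact: (W a b s t u v).
  apply: (W b a u v s t) => //; first by rewrite addnC.
  move=> x /H[sa sb [c c0 E]]; split=> //; exists (- c); first by rewrite oppr_eq0.
  by rewrite polyCN -E opprB mulrC [X in _ - X = _]mulrC.
(* Bound 0 means that the second remainder vanishes: its cofactors give the reduced fraction. *)
case: b ba => [|b] ba abm hs ht hu hv H.
  have [e1 E1] := poly_expressibleP (poly_expressibleN hv).
  have [e2 E2] := poly_expressibleP hu.
  exists (Output _ (e1, e2)) => x /H[_]; rewrite leqn0 size_poly_eq0 => /eqP uv [c c0 E].
  by rewrite /reduces /= E1 E2; apply: bezout_reduced c0 uv E.
case: a ba abm H => // a ba abm H.
pose r1 x := s x * n x + t x * d x; pose r2 x := u x * n x + v x * d x.
have hr1 : poly_expressible r1 by apply: poly_expressibleD; apply: poly_expressibleM.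
have hr2 : poly_expressible r2 by apply: poly_expressibleD; apply: poly_expressibleM.
have sr1 x : P x -> (size (r1 x) <= a.+1)%N by case/H.
have sr2 x : P x -> (size (r2 x) <= b.+1)%N by case/H.
(* The coefficients at the highest indices that the bounds allow; either may be zero. If g is, the
   second bound drops. *)
pose g x := (r2 x)`_b; pose h x := (r1 x)`_a.
apply: (@computable_ifzero _ g); first exact: hr2.2.
  apply: (IH a.+1 b s t u v) => //; first by rewrite -ltnS -addnS.
  move=> x [Px gx]; have [sa sb cE] := H x Px; split=> //.
  rewrite -/(r2 x); apply/leq_sizeP => i; rewrite leq_eqVlt => /orP[/eqP <- //|bi].
  by rewrite nth_default // (leq_trans (sr2 x Px)).
have comb_expressible f f' : poly_expressible f -> poly_expressible f' ->
    poly_expressible (fun x => g x *: f x - h x *: 'X^(a - b) * f' x).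
  move=> hf hf'; apply: poly_expressibleD.
    by apply: poly_expressibleZ => //; exact: hr2.2.
  apply: poly_expressibleN; apply: poly_expressibleM => //.
  by apply: poly_expressibleZ; [exact: hr1.2 | exact: poly_expressible_Xn].
(* With g nonzero, g r1 - h X^(a-b) r2 has coefficient 0 at index a, so the first bound drops; the
   determinant is multiplied by g. *)
apply: (IH a b.+1 _ _ u v _ _ (comb_expressible s u hs hu) (comb_expressible t v ht hv)) => //.
move=> x [Px gx]; have [sa sb [c c0 E]] := H x Px; split=> //; last first.
  exists (g x * c); first by rewrite mulf_neq0.
  rewrite polyCM -E -!mul_polyC; ring.
have -> : (g x *: s x - h x *: 'X^(a - b) * u x) * n x +
    (g x *: t x - h x *: 'X^(a - b) * v x) * d x =
    g x *: r1 x - h x *: ('X^(a - b) * r2 x) by rewrite /r1 /r2 -!mul_polyC; ring.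
apply/leq_sizeP => i ai; rewrite coefB !coefZ coefXnM ltnNge (leq_trans (leq_subr _ _) ai) /=.
move: ai; rewrite leq_eqVlt => /orP[/eqP <-|ai].
  by rewrite subKn // mulrC subrr.
rewrite [(r1 x)`_i]nth_default ?(leq_trans (sr1 x Px)) // mulr0 sub0r.
rewrite nth_default ?mulr0 ?oppr0 // (leq_trans (sr2 x Px)) //.
by rewrite ltn_subRL; apply: leq_ltn_trans ai; rewrite subnK.
Qed.

Lemma computable_reduced (P : T -> Prop) : computable P reduces.
Proof.
have [[a na] _] := hn; have [[b db] _] := hd.
apply: (@euclid a b (fun=> 1) (fun=> 0) (fun=> 0) (fun=> 1)) => [||||x _].
- exact: poly_expressible1.
- exact: poly_expressible0.
- exact: poly_expressible0.
- exact: poly_expressible1.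
rewrite !mul1r !mul0r addr0 add0r; split=> //; exists 1; rewrite ?oner_neq0 //.
by rewrite subr0.
Qed.

End Reduction.
End Computability.

(** * A common denominator for the row phi *)

Section CommonDenominator.
Variables (C : numClosedFieldType) (k : nat) (num den : 'I_k -> {poly C}).

(** A plain product, not a least common multiple: its coefficients are expressions in the data and,
    for nonzero [den j], its degree [common_deg] depends on the sizes only. *)
Definition common_den : {poly C} := \prod_j den j.
Definition common_num i : {poly C} := num i * \prod_(j | j != i) den j.
Definition common_deg : nat := \sum_j (size (den j)).-1.

Variable phi : 'rV[ratfun C]_k.
Hypotheses (phi_minus : forall j, Rminus (phi ord0 j))
           (phi_reduced : forall j, reduced (phi 0 j) (num j) (den j)).

Lemma den_neq0 j : den j != 0.
Proof. by case: (phi_reduced j). Qed.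

Lemma size_common_den : size common_den = common_deg.+1.
Proof.
rewrite size_prod => [|j _]; last exact: den_neq0.
rewrite (eq_bigr (fun j => (size (den j)).-1 + 1)%N) => [|j _]; last first.
  by rewrite addn1 prednK // lt0n size_poly_eq0 den_neq0.
by rewrite big_split /= sum1_card -addSn addnK.
Qed.

Lemma common_fraction i : phi 0 i = (common_num i)%:F / common_den%:F.
Proof.
have [_ _ {1}->] := phi_reduced i; apply/eqP; rewrite eqr_frac ?den_neq0 //.
  by rewrite /common_den (bigD1 i) //= mulrCA mulrC.
by apply/prodf_neq0 => j _; apply: den_neq0.
Qed.

(** [vanishes_at_infinity] refers to the canonical fraction; comparing sizes in the cross-multiplied
    identity carries the inequality over to p and q. *)
Lemma size_reduced_vanishing (f : ratfun C) (p q : {poly C}) :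
  reduced f p q -> vanishes_at_infinity f -> (size p < size q)%N.
Proof.
move=> [q0 _ fE] van; have [d0 _ fE'] := rnum_rdenP f.
have [->|p0] := eqVneq p 0; first by rewrite size_poly0 lt0n size_poly_eq0.
have E : p * rden f = rnum f * q by apply/eqP; rewrite -eqr_frac // -fE -fE'.
have n0 : rnum f != 0.
  by apply: contraNneq (mulf_neq0 p0 d0) => n0; rewrite E n0 mul0r.
have := congr1 (size : {poly C} -> nat) E; rewrite !size_mul // => E'.
have {}E' : (size p + size (rden f) = size (rnum f) + size q)%N.
  move: E'; rewrite -!size_poly_eq0 in p0 n0.
  by case: (size p) p0 => // a _; case: (size (rnum f)) n0 => // b _ /= E'; rewrite !addSn E'.
rewrite ltnNge; apply/negP => qp; have := leq_add qp van; rewrite E' addnC.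
by rewrite addSn ltnn.
Qed.

Lemma size_common_num i : (size (common_num i) <= common_deg.+1)%N.
Proof.
rewrite -size_common_den /common_num.
have -> : common_den = den i * \prod_(j | j != i) den j by rewrite /common_den (bigD1 i).
set P := \prod_(j | j != i) den j.
have P0 : P != 0 by apply/prodf_neq0 => j _; apply: den_neq0.
have [->|n0] := eqVneq (num i) 0; first by rewrite mul0r size_poly0.
rewrite !size_mul ?den_neq0 // -!subn1 leq_sub2r // leq_add2r ltnW //.
exact: size_reduced_vanishing (phi_reduced i) (phi_minus i).2.
Qed.

Lemma root_common_den a : root common_den a -> `|a| < 1.
Proof.
rewrite /root horner_prod => /prodf_eq0[j _ ra].
by apply: (phi_minus j).1; rewrite (pole_reduced _ (phi_reduced j)).
Qed.

Lemma common_unitary_factor :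
  unitary_factor phi (solution_mx common_deg common_num common_den).
Proof.
exact: (solution_mx_unitary_factor size_common_den size_common_num root_common_den
  common_fraction).
Qed.

Lemma common_system_unit :
  lin_mx (@system _ k common_deg common_num common_den) \in unitmx.
Proof.
exact: (system_unit size_common_den size_common_num root_common_den common_fraction).
Qed.

Lemma common_entry_den_neq0 (y : 'I_(k + 1)) : entry_den common_deg common_den y != 0.
Proof. exact: (entry_den_neq0 size_common_den). Qed.

End CommonDenominator.

(** * A computation tree for each data format *)

Section Construction.
Variables (C : numClosedFieldType) (k : nat) (fmt : 'I_k -> nat * nat * nat).

(** Restricting the inputs to admissible data of one format makes the linear system invertible at
    every input, as Cramer's rule requires, and bounds all sizes uniformly. *)
Definition valid_data : Type :=
  {D : rowdata C k | data_format D = fmt /\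
     exists2 phi : 'rV[ratfun C]_k, (forall j, Rminus (phi ord0 j)) & describes D phi}.

Lemma construction : exists t : tree (datum k) ('I_(k + 1) -> 'I_(k + 1) ->
    seq (expr (datum k)) * seq (expr (datum k))), forall D : rowdata C k,
  data_format D = fmt -> forall phi : 'rV[ratfun C]_k, (forall j, Rminus (phi ord0 j)) -> describes D phi ->
  forall i j, reduced (solution_mx (common_deg (rd_den D))
      (common_num (rd_num D) (rd_den D)) (common_den (rd_den D)) i j)
    (eval_poly (data_env D) (run (data_env D) t i j).1)
    (eval_poly (data_env D) (run (data_env D) t i j).2).
Proof.
pose env (x : valid_data) := data_env (sval x).
(* The component [.1.2] of the format is the size of a denominator, so the degree is known before
   the data are read. *)
pose N := (\sum_j ((fmt j).1.2).-1)%N.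
have degE (D : rowdata C k) : data_format D = fmt -> common_deg (rd_den D) = N.
  by move=> fD; rewrite /N -fD.
pose p i (x : valid_data) := common_num (rd_num (sval x)) (rd_den (sval x)) i.
pose q (x : valid_data) := common_den (rd_den (sval x)).
have hden j : poly_expressible env (fun x => rd_den (sval x) j).
  split; first by exists (fmt j).1.2 => -[D [fD ?]] /=; rewrite -fD.
  by move=> l; apply: eq_expressible (expressible_var env (DenCoef j l)).
have hnum j : poly_expressible env (fun x => rd_num (sval x) j).
  split; first by exists (fmt j).1.1 => -[D [fD ?]] /=; rewrite -fD.
  by move=> l; apply: eq_expressible (expressible_var env (NumCoef j l)).
have hp i : poly_expressible env (p i).
  by apply: poly_expressibleM => //; apply: poly_expressible_prod.
have hq : poly_expressible env q by apply: poly_expressible_prod.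
have unit x : lin_mx (@system _ k N (p ^~ x) (q x)) \in unitmx.
  case: x => D [fD [phi phi_minus descr]]; rewrite -(degE D fD).
  exact: (common_system_unit phi_minus (fun j => (descr j).1)).
have den0 (y : 'I_(k + 1)) x : entry_den N (q x) y != 0.
  case: x => D [fD [phi phi_minus descr]]; rewrite -(degE D fD).
  exact: (common_entry_den_neq0 (fun j => (descr j).1)).
(* Each entry of the solution is already a quotient of expressible polynomials; only its reduction
   to lowest terms branches. *)
have H (ij : 'I_(k + 1) * 'I_(k + 1)) : computable env (fun=> True) (reduces env
    (fun x => entry_num (solution N (p ^~ x) (q x) ij.2) ij.1)
    (fun x => entry_den N (q x) ij.1)).
  apply: computable_reduced => //.
    by apply: poly_expressible_entry_num; apply: mx_expressible_solution.
  exact: poly_expressible_entry_den.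
have [t Ht] := computable_family ([::], [::]) H.
exists (tree_bind t (fun o => Output _ (fun i j => o (i, j)))).
move=> D fD phi phi_minus descr i j.
pose x : valid_data := exist _ D (conj fD (ex_intro2 _ _ phi phi_minus descr)).
rewrite -[data_env D]/(env x) run_bind mxE (degE D fD).
exact: (Ht x I (i, j)).
Qed.

End Construction.

Theorem theorem1p1 (R : realType) (k : nat) (k_gt0 : (0 < k)%N) :
  (forall phi : 'rV[ratfun R[i]]_k,
     (forall j : 'I_k, Rminus (phi ord0 j)) ->
     exists! U : 'M[ratfun R[i]]_(k + 1), unitary_factor phi U)
  /\
  (exists A : algorithm k,
     forall (phi : 'rV[ratfun R[i]]_k) (D : rowdata R[i] k),
       (forall j : 'I_k, Rminus (phi ord0 j)) ->
       describes D phi ->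
       forall U : 'M[ratfun R[i]]_(k + 1),
         unitary_factor phi U -> constructs A D U).
Proof.
split=> [phi phi_minus|].
  (* Existence takes the canonical reduced forms of the phi_j as data. *)
  have := common_unitary_factor phi_minus (fun j => rnum_rdenP (phi 0 j)).
  by eexists; split; [eassumption | move=> U; apply: unitary_factor_unique].
have [A HA] := choice (@construction R[i] k).
exists A => phi D phi_minus descr U hU; rewrite /constructs /= => i j.
have hS := common_unitary_factor phi_minus (fun j => (descr j).1).
(* By uniqueness the given U is the matrix computed from the data. *)
rewrite (unitary_factor_unique hU hS).
exact: (HA _ D erefl phi phi_minus descr i j).
Qed.
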